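(* Let $l,\mathcal{D},\mathcal{D}_g,G$ and the constants $\gamma,\beta_x,\beta_z,\epsilon,\epsilon_g$ satisfy Assumptions (A1)--(A4) listed in the context, and let $x_s$ be a constrained equilibrium point. Suppose that $$\gamma-\epsilon\beta_z-\frac{\epsilon_g(\epsilon\beta_z+\beta_x)}{\sqrt{\lambda_{\min}(GG^{\mathrm T})}}>0$$ and $$(\gamma-\epsilon\beta_z)^2-\frac{2\epsilon_g(\epsilon\beta_z+\beta_x)(\gamma+\beta_x)}{\sqrt{\lambda_{\min}(GG^{\mathrm T})}}>0 .$$ Define $$c_2=(\epsilon\beta_z+\beta_x)^2,\qquad c_1=\gamma-\epsilon\beta_z-\frac{\epsilon_g(\epsilon\beta_z+\beta_x)}{\sqrt{\lambda_{\min}(GG^{\mathrm T})}},\qquad c_0=\frac{\epsilon_g^2}{\lambda_{\min}(GG^{\mathrm T})}+\frac{2\epsilon_g}{\sqrt{\lambda_{\min}(GG^{\mathrm T})}},$$ $$\Delta=4c_1^2-4c_2c_0,\qquad s_1=\frac{2c_1-\sqrt{\Delta}}{2c_2},\qquad s_2=\frac{2c_1+\sqrt{\Delta}}{2c_2}.$$ Then $s_2>s_1\ge 0$, and for every step size $\eta\in(s_1,s_2)$ one has $\kappa:=c_2\eta^2-2\eta c_1+c_0+1<1$, and the sequence $\{x_t\}$ generated from any initial point $x_0\in\mathbb{R}^n$ by the repeated projected gradient descent update $$x_{t+1}=P_{S(x_t)}\left\{x_t-\eta\nabla f_{x_t}(x_t)\right\},\qquad t=0,1,2,\ldots,$$ satisfies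 $$\|x_{t+1}-x_s\|^2\le \kappa^t\|x_1-x_s\|^2\qquad\text{for all } t\ge 0 .$$
   Context: Setting. $\mathbb{R}^n$ carries the standard inner product $\langle\cdot,\cdot\rangle$ and the Euclidean norm $\|\cdot\|$; vector inequalities are componentwise; $\lambda_{\min}(Q)$ is the smallest eigenvalue of a positive definite matrix $Q$. Let $G\in\mathbb{R}^{d_w\times n}$, and let $l:\mathbb{R}^n\times\mathbb{R}^{d_z}\to\mathbb{R}$ be twice continuously differentiable. The distribution maps $\mathcal{D}$ and $\mathcal{D}_g$ assign to each $x\in\mathbb{R}^n$ a Borel probability distribution $\mathcal{D}(x)$ on $\mathbb{R}^{d_z}$, supported in a set $\mathcal{Z}\subseteq\mathbb{R}^{d_z}$, and a Borel probability distribution $\mathcal{D}_g(x)$ on $\mathbb{R}^{d_w}$. These distributions have finite first moments and all expectations below are assumed well defined and finite. $W_1$ denotes the 1-Wasserstein (earth mover's) distance with respect to the Euclidean norm. Notation. For $x',x\in\mathbb{R}^n$, $$f_{x'}(x)=\mathbb{E}_{z\sim\mathcal{D}(x')}[l(x,z)],\quad \xi(x')=\mathbb{E}_{w\sim\mathcal{D}_g(x')}[w],\quad S(x')=\{x\in\mathbb{R}^n: Gx\le\xi(x')\}.$$ $\nabla f_{x'}(x)$ is the gradient of $f_{x'}$ with respect to its argument, at $x$ (with $x'$ held fixed), so $\nabla f_{x_t}(x_t)$ is the gradient of $f_{x_t}$ evaluated at $x_t$. $P_S\{y\}=\arg\min_{x\in S}\frac12\|x-y\|^2$ is the Euclidean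 projection onto a closed convex set $S$. A constrained equilibrium point is a vector $x_s\in\mathbb{R}^n$ with $x_s=\arg\min_x\{f_{x_s}(x): Gx\le\xi(x_s)\}$, i.e. $x_s$ is the minimizer of $f_{x_s}$ over $S(x_s)$. Assumptions (with $\gamma>0$ and $\beta_x,\beta_z,\epsilon,\epsilon_g\ge 0$): (A1) $l(x,z)$ is $\gamma$-strongly convex in $x$ for every $z\in\mathcal{Z}$: $l(x_1,z)\ge l(x_2,z)+\langle\nabla_x l(x_2,z),x_1-x_2\rangle+\frac{\gamma}{2}\|x_1-x_2\|^2$ for all $x_1,x_2\in\mathbb{R}^n$. (A2) $\|\nabla_x l(x,z)-\nabla_x l(x,z')\|\le\beta_z\|z-z'\|$ for all $x\in\mathbb{R}^n$, $z,z'\in\mathcal{Z}$, and $\|\nabla_x l(x_1,z)-\nabla_x l(x_2,z)\|\le\beta_x\|x_1-x_2\|$ for all $x_1,x_2\in\mathbb{R}^n$, $z\in\mathcal{Z}$. (A3) $W_1(\mathcal{D}(x),\mathcal{D}(y))\le\epsilon\|x-y\|$ and $W_1(\mathcal{D}_g(x),\mathcal{D}_g(y))\le\epsilon_g\|x-y\|$ for all $x,y\in\mathbb{R}^n$. (A4) $G$ has full row rank. *)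

(* Defs.v *)
From HB Require Import structures.
From mathcomp Require Import all_boot all_order all_algebra.
From mathcomp Require Import all_classical all_reals all_analysis.

Set Implicit Arguments.
Unset Strict Implicit.
Unset Printing Implicit Defensive.

Import Order.TTheory GRing.Theory Num.Theory.
Import numFieldNormedType.Exports.

Local Open Scope classical_set_scope.
Local Open Scope ring_scope.

(* Points of R^d are row vectors.  The norm `|x| provided by the library on
   'rV[R]_d is the sup norm: it induces the usual topology, but it is not the
   Euclidean norm, whence enorm. *)
Definition inner {R : realType} {d : nat} (x y : 'rV[R]_d) : R :=
  \sum_(i < d) x 0 i * y 0 i.

Definition enorm {R : realType} {d : nat} (x : 'rV[R]_d) : R :=
  Num.sqrt (inner x x).

Definition gradient {R : realType} {d : nat} (f : 'rV[R]_d -> R)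
    (x : 'rV[R]_d) : 'rV[R]_d :=
  \row_(i < d) 'D_(delta_mx 0 i) f x.

(* On a finite-dimensional V (the only use here), continuity of x |-> 'd f x v
   for every fixed v is continuity of x |-> 'd f x in operator norm. *)
Definition continuously_differentiable {R : realType} {V W : normedModType R}
    (f : V -> W) : Prop :=
  (forall x, differentiable f x) /\
  (forall v, continuous (fun x => 'd f x v)).

Definition twice_continuously_differentiable {R : realType}
    {V W : normedModType R} (f : V -> W) : Prop :=
  continuously_differentiable f /\
  (forall v, continuously_differentiable (fun x => 'd f x v)).

(* The type 'rV[R]_d equipped with its Borel sigma-algebra. *)
Definition borel_rV (R : realType) (d : nat) :=
  g_sigma_algebraType (@open 'rV[R]_d).

Definition coupling {R : realType} {d : nat}
    (mu nu : probability (borel_rV R d) R) :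
    set (probability (borel_rV R d * borel_rV R d)%type R) :=
  [set pi | forall A : set (borel_rV R d), measurable A ->
     pi (A `*` setT) = mu A /\ pi (setT `*` A) = nu A].

Definition W1 {R : realType} {d : nat}
    (mu nu : probability (borel_rV R d) R) : \bar R :=
  ereal_inf [set (\int[pi]_p (enorm (p.1 - p.2 : 'rV[R]_d))%:E)%E
            | pi in coupling mu nu].

(* The infimum is a minimum for symmetric A of positive size: the set of
   eigenvalues is then finite and nonempty. *)
Definition lambda_min {R : realType} {d : nat} (A : 'M[R]_d) : R :=
  inf [set a : R | eigenvalue A a].

Definition argmin {R : realType} {T : Type} (S : set T) (F : T -> R) : set T :=
  [set x | S x /\ forall y, S y -> F x <= F y].

(* [get] selects the minimizer, which exists and is unique when S is a
   nonempty closed convex set. *)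
Definition euclidean_proj {R : realType} {d : nat} (S : set 'rV[R]_d)
    (y : 'rV[R]_d) :
    'rV[R]_d :=
  get (argmin S (fun x => 2^-1 * enorm (x - y) ^+ 2)).

Section decision_dependent_program.
Context {R : realType} {n dw dz : nat}.
Variables (l : 'rV[R]_n -> 'rV[R]_dz -> R) (G : 'M[R]_(dw, n)).
Variables (D : 'rV[R]_n -> probability (borel_rV R dz) R)
          (Dg : 'rV[R]_n -> probability (borel_rV R dw) R).

(* [exp_loss x' x] is f_{x'}(x). *)
Definition exp_loss (x' x : 'rV[R]_n) : R := \int[D x']_z l x z.

Definition exp_rhs (x' : 'rV[R]_n) : 'rV[R]_dw :=
  \row_(i < dw) \int[Dg x']_w (w : 'rV[R]_dw) 0 i.

Definition feasible (x' : 'rV[R]_n) : set 'rV[R]_n :=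
  [set x | forall i, (G *m x^T) i 0 <= exp_rhs x' 0 i].

Definition equilibrium (xs : 'rV[R]_n) : Prop :=
  argmin (feasible xs) (exp_loss xs) xs.

Definition rpgd_step (eta : R) (x : 'rV[R]_n) : 'rV[R]_n :=
  euclidean_proj (feasible x) (x - eta *: gradient (exp_loss x) x).

End decision_dependent_program.

(* Main.v *)
Require Import Defs.
From HB Require Import structures.
From mathcomp Require Import all_boot all_order all_algebra.
From mathcomp Require Import all_classical all_reals all_analysis.
From mathcomp Require Import measurable_realfun.
From mathcomp Require Import ring lra.

Set Implicit Arguments.
Unset Strict Implicit.
Unset Printing Implicit Defensive.

Import Order.TTheory GRing.Theory Num.Theory.
Import numFieldNormedType.Exports.

Local Open Scope classical_set_scope.
Local Open Scope ring_scope.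

(* Idea.  Strong convexity and the Lipschitz gradient squeeze
   l(x + v, z) - l(x, z) - <grad l(x, z), v> between 0 and beta_x |v|^2; taking
   expectations, the gradient of f_{x'} is the expected gradient of l, and
   Wasserstein duality makes it (eps beta_z)-Lipschitz in x'.  With
   a = gamma - eps beta_z and b = eps beta_z + beta_x, one gradient step thus
   satisfies |y_t - y_s|^2 <= (1 - 2 eta a + eta^2 b^2) |x_t - x_s|^2, where
   y_s = x_s - eta grad f_{x_s}(x_s).

   Since G has full row rank, a change d of the right-hand side lifts to some e
   with G e = d and |e| <= |d| / sqrt lambda_min(G G^T), and S(xi + d) = S(xi) + e.
   Testing each projection's variational inequality against the translate of
   the other projection gives |p - p'|^2 <= |y - y'|^2 + |e|^2, with no need for
   multipliers.  The resulting factor 1 - 2 eta a + eta^2 b^2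
   + eps_g^2 / lambda_min is at most kappa. *)

(** Dividing by [t] and letting [t] tend to 0 gives the claim. This is the first-order condition
    behind all minimality arguments below: Rayleigh quotient, projection and equilibrium. *)
Lemma linear_coef_ge0 (R : realFieldType) (b c : R) :
  (forall t, 0 < t <= 1 -> 0 <= t * b + t ^+ 2 * c) -> 0 <= b.
Proof.
move=> H; rewrite leNgt; apply/negP => b0.
have c0 : 0 <= `|c| by [].
have cc : c <= `|c| by exact: ler_norm.
have d0 : 0 < `|c| - b by lra.
(* An explicit [t] replaces the limit: for it [b + t * |c| = t * b], which is negative when
   [b < 0]. *)
have tP : 0 < - b / (`|c| - b) by apply: divr_gt0 => //; lra.
have t1 : - b / (`|c| - b) <= 1 by rewrite ler_pdivrMr // mul1r; lra.
have /H : 0 < - b / (`|c| - b) <= 1 by rewrite tP t1.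
set t := - b / _ in tP t1 *.
have tE : t * (`|c| - b) = - b by rewrite /t divfK // gt_eqF.
have : t * (b + t * c) < 0; last by rewrite expr2; lra.
rewrite pmulr_rlt0 //.
have : t * c <= t * `|c| by rewrite ler_pM2l.
have : t * - b > 0 by rewrite mulr_gt0 // oppr_gt0.
lra.
Qed.

(** * Euclidean geometry *)

Section inner_product.
Context {R : realType} {d : nat}.
Implicit Types (x y z u v : 'rV[R]_d) (a : R).

Lemma innerC x y : inner x y = inner y x.
Proof. by apply: eq_bigr => i _; rewrite mulrC. Qed.

Lemma innerDl x y z : inner (x + y) z = inner x z + inner y z.
Proof. by rewrite -big_split; apply: eq_bigr => i _; rewrite !mxE mulrDl. Qed.

Lemma innerZl a x y : inner (a *: x) y = a * inner x y.
Proof. by rewrite mulr_sumr; apply: eq_bigr => i _; rewrite !mxE mulrA. Qed.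

Lemma innerDr x y z : inner x (y + z) = inner x y + inner x z.
Proof. by rewrite innerC innerDl !(innerC x). Qed.

Lemma innerZr a x y : inner x (a *: y) = a * inner x y.
Proof. by rewrite innerC innerZl innerC. Qed.

Lemma innerNl x y : inner (- x) y = - inner x y.
Proof. by rewrite -scaleN1r innerZl mulN1r. Qed.

Lemma innerNr x y : inner x (- y) = - inner x y.
Proof. by rewrite innerC innerNl innerC. Qed.

Lemma inner0l y : inner 0 y = 0.
Proof. by rewrite -(scale0r 0) innerZl mul0r. Qed.

Lemma inner0r y : inner y 0 = 0.
Proof. by rewrite innerC inner0l. Qed.

Definition innerE := (innerDl, innerDr, innerNl, innerNr, innerZl, innerZr).

Lemma inner_mulmx x y : x *m y^T = (inner x y)%:M.
Proof.
apply/rowP => i; rewrite ord1 !mxE mulr1n.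
by apply: eq_bigr => k _; rewrite !mxE.
Qed.

Lemma inner_ge0 x : 0 <= inner x x.
Proof. by apply: sumr_ge0 => i _; rewrite -expr2 sqr_ge0. Qed.

Lemma inner_eq0 x : (inner x x == 0) = (x == 0).
Proof.
apply/eqP/eqP => [x0|->]; last exact: inner0l.
apply/rowP => i; rewrite mxE; apply/eqP; rewrite -sqrf_eq0 expr2; apply/eqP.
by move/psumr_eq0P: x0; apply=> // k _; rewrite -expr2 sqr_ge0.
Qed.

Lemma enorm_ge0 x : 0 <= enorm x. Proof. exact: sqrtr_ge0. Qed.

Lemma sqr_enorm x : enorm x ^+ 2 = inner x x.
Proof. by rewrite sqr_sqrtr ?inner_ge0. Qed.

Lemma enorm_eq0 x : (enorm x == 0) = (x == 0).
Proof. by rewrite -sqrf_eq0 sqr_enorm inner_eq0. Qed.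

Lemma enorm_gt0 x : (0 < enorm x) = (x != 0).
Proof. by rewrite lt_def enorm_ge0 andbT enorm_eq0. Qed.

Lemma enormZ a x : enorm (a *: x) = `|a| * enorm x.
Proof.
by rewrite /enorm innerZl innerZr mulrA -expr2 sqrtrM ?sqr_ge0// sqrtr_sqr.
Qed.

Lemma enormN x : enorm (- x) = enorm x.
Proof. by rewrite -scaleN1r enormZ normrN1 mul1r. Qed.

(** Cauchy-Schwarz: the squared norm of [enorm y *: x - enorm x *: y] is twice [enorm x * enorm y]
    times the difference of the two sides. *)
Lemma inner_le_enorm x y : inner x y <= enorm x * enorm y.
Proof.
have [->|x0] := eqVneq x 0.
  by rewrite inner0l mulr_ge0 ?enorm_ge0.
have [->|y0] := eqVneq y 0.
  by rewrite inner0r mulr_ge0 ?enorm_ge0.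
have px : 0 < enorm x by rewrite enorm_gt0.
have py : 0 < enorm y by rewrite enorm_gt0.
have := inner_ge0 (enorm y *: x - enorm x *: y).
rewrite !innerE (innerC y x) -!sqr_enorm => h.
have : 0 <= (enorm x * enorm y) * (enorm x * enorm y - inner x y) by lra.
by rewrite pmulr_rge0 ?mulr_gt0// subr_ge0.
Qed.

Lemma enormD x y : enorm (x + y) <= enorm x + enorm y.
Proof.
rewrite -ler_sqr ?nnegrE ?addr_ge0 ?enorm_ge0//.
rewrite sqr_enorm !innerE (innerC y x) -!sqr_enorm.
by have := inner_le_enorm x y; lra.
Qed.

(** The choice [v = x] suffices. This form reduces norm bounds on vectors of expectations to bounds
    on scalar integrals. *)
Lemma enorm_le_inner x (K : R) : 0 <= K ->
  (forall v, inner x v <= K * enorm v) -> enorm x <= K.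
Proof.
move=> K0 /(_ x); rewrite -sqr_enorm expr2.
have [->|] := eqVneq (enorm x) 0; first by [].
by move=> nx; rewrite ler_pM2r // lt_def nx enorm_ge0.
Qed.

Lemma inner_delta x i : inner x (delta_mx 0 i) = x 0 i.
Proof.
rewrite /inner (bigD1 i)//= big1 => [|j ji].
  by rewrite mxE !eqxx mulr1 addr0.
by rewrite mxE (negbTE ji) andbF mulr0.
Qed.

Lemma enorm_delta i : enorm (delta_mx 0 i : 'rV[R]_d) = 1.
Proof. by rewrite /enorm inner_delta mxE !eqxx sqrtr1. Qed.

Lemma normr_coord_le x i : `|x 0 i| <= enorm x.
Proof.
have := enorm_delta i.
rewrite -inner_delta ler_norml => di; apply/andP; split.
  rewrite lerNl -innerNl.
  by apply: le_trans (inner_le_enorm _ _) _; rewrite enormN di mulr1.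
by apply: le_trans (inner_le_enorm _ _) _; rewrite di mulr1.
Qed.

Lemma coord_continuous_rV i : continuous (fun x : 'rV[R]_d => x 0 i).
Proof. exact: coord_continuous. Qed.

Lemma continuous_inner (T : topologicalType) (f g : T -> 'rV[R]_d) :
  (forall i, continuous (fun t => f t 0 i)) ->
  (forall i, continuous (fun t => g t 0 i)) ->
  continuous (fun t => inner (f t) (g t)).
Proof.
move=> cf cg; rewrite /inner; elim: (index_enum _) => [|i r IH].
  by under eq_fun do rewrite big_nil; move=> t; exact: cvg_cst.
under eq_fun do rewrite big_cons; move=> t.
by apply: cvgD; [apply: cvgM; [exact: cf|exact: cg]|exact: IH].
Qed.

(** [bounded_set] refers to the sup norm, which the Euclidean norm dominates coordinate by
    coordinate. *)
Lemma bounded_enorm (A : set 'rV[R]_d) (M : R) :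
  (forall x, A x -> enorm x <= M) -> bounded_set A.
Proof.
move=> AM; exists M; split; first exact: num_real.
move=> N MN x Ax.
have N0 : 0 <= N by rewrite (le_trans (enorm_ge0 x)) // (le_trans (AM _ Ax)) // ltW.
rewrite /= [leLHS]/Num.norm /= mx_normrE; apply/bigmax_leP; split=> //= -[i j] _ /=.
by rewrite ord1 (le_trans (normr_coord_le _ _)) // (le_trans (AM _ Ax)) // ltW.
Qed.

End inner_product.

Lemma inner_mulmxl (R : realType) (m n : nat) (x : 'rV[R]_m) (A : 'M[R]_(m, n))
    (y : 'rV[R]_n) : inner (x *m A) y = inner x (y *m A^T).
Proof.
have := inner_mulmx (x *m A) y; rewrite -mulmxA -{1}(trmxK A) -trmx_mul inner_mulmx.
by move=> /matrixP/(_ 0 0); rewrite !mxE !mulr1n.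
Qed.

(** * The Gram matrix of a full-row-rank matrix and its smallest eigenvalue *)

Section gram.
Context {R : realType} {m n : nat} (G : 'M[R]_(m, n)).
Hypothesis fG : row_free G.

Lemma row_free_mulmx_eq0 (v : 'rV[R]_m) : (v *m G == 0) = (v == 0).
Proof.
apply/eqP/eqP => [vG|->]; last by rewrite mul0mx.
by have /row_freeP[B GB] := fG; rewrite -[v]mulmx1 -GB mulmxA vG mul0mx.
Qed.

Lemma gram_unitmx : G *m G^T \in unitmx.
Proof.
rewrite -row_free_unit; apply: inj_row_free => v vGG.
apply/eqP; rewrite -row_free_mulmx_eq0 -inner_eq0 inner_mulmxl -mulmxA vGG.
by rewrite inner0r.
Qed.

Lemma continuous_mulmx_coord i : continuous (fun v : 'rV[R]_m => (v *m G) 0 i).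
Proof.
pose c := \row_k G k i.
have -> : (fun v : 'rV[R]_m => (v *m G) 0 i) = (fun v => inner v c).
  by apply/funext => v; rewrite mxE; apply: eq_bigr => k _; rewrite mxE.
apply: continuous_inner => j; first exact: coord_continuous_rV.
exact: cst_continuous.
Qed.

(** The continuous function [|v G|^2] attains its minimum on the compact unit sphere, nonempty since
    [0 < m]; homogeneity extends the bound to every [u]. *)
Lemma rayleigh_min : (0 < m)%N ->
  exists2 v : 'rV[R]_m, inner v v = 1 &
    forall u, inner (v *m G) (v *m G) * inner u u <= inner (u *m G) (u *m G).
Proof.
move=> m0; pose i0 := Ordinal m0; pose A := [set v : 'rV[R]_m | inner v v = 1].
have A0 : A !=set0.
  by exists (delta_mx 0 i0); rewrite /A /= inner_delta mxE !eqxx.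
have cA : compact A.
  apply: bounded_closed_compact.
    by apply: (@bounded_enorm _ _ _ 1) => v /= v1; rewrite /enorm v1 sqrtr1.
  apply: (@preimage_closed _ _ (fun v : 'rV[R]_m => inner v v) [set x | x = 1]).
    by move=> v _; apply: continuous_inner => i; exact: coord_continuous_rV.
  exact: closed_eq.
have cQ : continuous (fun v : 'rV[R]_m => inner (v *m G) (v *m G)).
  by apply: continuous_inner => i; exact: continuous_mulmx_coord.
have [v /set_mem Av minv] := EVT_min_rV A0 cA (continuous_subspaceT cQ).
exists v => // u; have [->|u0] := eqVneq u 0.
  by rewrite mul0mx !inner0l mulr0.
have nu : 0 < enorm u by rewrite enorm_gt0.
have := minv ((enorm u)^-1 *: u); rewrite inE /A /= !(innerZl, innerZr, =^~ scalemxAl).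
rewrite !mulrA -!expr2 -(sqr_enorm u) -exprMn mulVf ?gt_eqF// expr1n => /(_ erefl) h.
by rewrite mulrC -ler_pdivlMl ?exprn_gt0// -exprVn.
Qed.

(** The minimal Rayleigh quotient [a] is a lower bound for the eigenvalues and is itself one, so it
    equals the infimum [lambda_min]; injectivity of [v |-> v G] makes it positive. *)
Lemma lambda_min_gram : (0 < m)%N ->
  let lam := lambda_min (G *m G^T) in
  0 < lam /\ forall u, lam * inner u u <= inner (u *m G) (u *m G).
Proof.
move=> /rayleigh_min[v v1 minv] lam.
set a := inner (v *m G) (v *m G) in minv.
have v0 : v != 0 by rewrite -inner_eq0 v1 oner_eq0.
have a0 : 0 < a by rewrite /a -sqr_enorm exprn_gt0// enorm_gt0 row_free_mulmx_eq0.
have lb : lbound [set b : R | eigenvalue (G *m G^T) b] a.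
  move=> b /= /eigenvalueP[w wG w0].
  have ww : 0 < inner w w by rewrite -sqr_enorm exprn_gt0// enorm_gt0.
  have := minv w; rewrite inner_mulmxl -mulmxA wG innerZr.
  by rewrite ler_pM2r.
have av : eigenvalue (G *m G^T) a.
  (* Perturbing the minimizer to [v + t u] leaves [2 t <v G G^T - a v, u>] as the linear term.
     Taking [u] to be minus the residual [v G G^T - a v] then shows that the residual vanishes. *)
  have H u : 0 <= inner (v *m (G *m G^T) - a *: v) u.
    suff : 0 <= 2 * inner (v *m (G *m G^T) - a *: v) u by rewrite pmulr_rge0.
    apply: (@linear_coef_ge0 _ _ (inner (u *m G) (u *m G) - a * inner u u)) => t _.
    have := minv (v + t *: u); rewrite mulmxDl -scalemxAl !innerE v1.
    rewrite (innerC u v) (innerC (u *m G) (v *m G)) -/a mulmxA.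
    rewrite (innerC (v *m G *m G^T)) -inner_mulmxl (innerC (u *m G)).
    lra.
  apply/eigenvalueP; exists v => //; apply/eqP; rewrite -subr_eq0 -inner_eq0.
  by rewrite eq_le inner_ge0 -oppr_ge0 -innerNr H.
have -> : lam = a.
  apply/eqP; rewrite eq_le ge_inf//=; last by exists a.
  by apply: lb_le_inf => //; exists a.
by split.
Qed.

(** The least-norm solution [e = mu G] with [mu = d (G G^T)^-1] works:
    [|e|^2 = <mu, d> <= |mu| |d|], while [sqrt lam * |mu| <= |e|]. *)
Lemma gram_solve (d : 'rV[R]_m) : (0 < m)%N ->
  exists2 e : 'rV[R]_n, e *m G^T = d &
    enorm e <= enorm d / Num.sqrt (lambda_min (G *m G^T)).
Proof.
move=> /lambda_min_gram; set lam := lambda_min _ => -[lam0 lamP].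
pose mu := d *m invmx (G *m G^T).
have muE : mu *m G *m G^T = d by rewrite -mulmxA mulmxKV// gram_unitmx.
exists (mu *m G) => //; rewrite ler_pdivlMr ?sqrtr_gt0//.
have [->|m0] := eqVneq (mu *m G) 0.
  by rewrite /enorm inner0l sqrtr0 mul0r sqrtr_ge0.
have e0 : 0 < enorm (mu *m G) by rewrite enorm_gt0.
rewrite -(ler_pM2l e0) mulrA -expr2 sqr_enorm inner_mulmxl muE.
have h1 : Num.sqrt lam * enorm mu <= enorm (mu *m G).
  by rewrite /enorm -sqrtrM ?(ltW lam0)//; apply: ler_wsqrtr; exact: lamP.
rewrite (le_trans (ler_wpM2r (sqrtr_ge0 _) (inner_le_enorm _ _)))//.
by rewrite mulrAC (mulrC (enorm mu)); apply: ler_wpM2r; [exact: enorm_ge0|].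
Qed.
End gram.

(** * Projections onto polyhedra *)

Section projection.
Context {R : realType} {n : nat} (S : set 'rV[R]_n).
Hypotheses (S0 : S !=set0) (cS : closed S).
Hypothesis convS :
  forall x y (t : R), S x -> S y -> 0 < t <= 1 -> S (x + t *: (y - x)).

(** Minimality along the segment from the projection to [z] gives the variational inequality. Since
    [get] is meaningful only when a minimizer exists, existence is proved as well. *)
Lemma euclidean_projP y : S (euclidean_proj S y) /\
  forall z, S z -> inner (y - euclidean_proj S y) (z - euclidean_proj S y) <= 0.
Proof.
suff : argmin S (fun x => 2^-1 * enorm (x - y) ^+ 2) (euclidean_proj S y).
  set p := euclidean_proj S y => -[Sp minp]; split => // z Sz.
  suff : 0 <= 2 * inner (p - y) (z - p).
    by rewrite -(opprB p y) innerNl oppr_le0 pmulr_rge0.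
  apply: (@linear_coef_ge0 _ _ (inner (z - p) (z - p))) => t t01.
  have := minp _ (convS Sp Sz t01).
  rewrite -addrA (addrC (t *: _)) addrA !sqr_enorm.
  rewrite ler_pM2l ?invr_gt0//; move: (p - y) (z - p) => a b.
  rewrite !innerE (innerC b a); lra.
rewrite /euclidean_proj; apply: getPex.
have [a Sa] := S0.
(* Only points at least as close to [y] as [a] can matter; they form a compact set. *)
pose B := S `&` [set x | inner (x - y) (x - y) <= inner (a - y) (a - y)].
have cf : continuous (fun x : 'rV[R]_n => inner (x - y) (x - y)).
  have ci i : continuous (fun x : 'rV[R]_n => (x - y) 0 i).
    under eq_fun do rewrite mxE; move=> x.
    by apply: continuousD; [exact: coord_continuous_rV|exact: cst_continuous].
  exact: continuous_inner.
have cB : compact B.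
  apply: bounded_closed_compact.
    apply: (@bounded_enorm _ _ _ (enorm (a - y) + enorm y)) => x [_ /= xa].
    rewrite -[x](subrK y) (le_trans (enormD _ _))// lerD2r.
    exact: ler_wsqrtr.
  apply: closedI => //.
  apply: (@preimage_closed _ _ (fun x : 'rV[R]_n => inner (x - y) (x - y))
    [set r | r <= inner (a - y) (a - y)]); last exact: closed_le.
  by move=> x _; exact: cf.
have B0 : B !=set0 by exists a; split => /=.
have [p /set_mem[Sp pa] minp] := EVT_min_rV B0 cB (continuous_subspaceT cf).
exists p; split => // z Sz; rewrite !sqr_enorm ler_pM2l ?invr_gt0//.
have [za|/ltW az] := leP (inner (z - y) (z - y)) (inner (a - y) (a - y)).
  by apply: minp; rewrite inE.
exact: le_trans pa az.
Qed.

End projection.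

(** * Polyhedra with a varying right-hand side *)

Section polyhedron.
Context {R : realType} {m n : nat} (G : 'M[R]_(m, n)).

Definition polyhedron (xi : 'rV[R]_m) : set 'rV[R]_n :=
  [set x | forall i, (G *m x^T) i 0 <= xi 0 i].

Lemma polyhedronE xi x :
  polyhedron xi x <-> forall i, (x *m G^T) 0 i <= xi 0 i.
Proof.
have E i : (G *m x^T) i 0 = (x *m G^T) 0 i.
  by rewrite -[x in RHS]trmxK -trmx_mul [RHS]mxE.
by split=> H i; [rewrite -E|rewrite E]; exact: H.
Qed.

Lemma closed_polyhedron xi : closed (polyhedron xi).
Proof.
have -> : polyhedron xi = \bigcap_i [set x | (x *m G^T) 0 i <= xi 0 i].
  apply/seteqP; split => x.
    by move=> /polyhedronE H i _; exact: H.
  by move=> H; apply/polyhedronE => i; exact: H.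
apply: closed_bigI => i _.
apply: (@preimage_closed _ _ (fun x : 'rV[R]_n => (x *m G^T) 0 i) [set r | r <= xi 0 i]);
  last exact: closed_le.
by move=> x _; exact: continuous_mulmx_coord.
Qed.

Lemma convex_polyhedron xi x y (t : R) : polyhedron xi x -> polyhedron xi y ->
  0 < t <= 1 -> polyhedron xi (x + t *: (y - x)).
Proof.
move=> /polyhedronE Hx /polyhedronE Hy /andP[t0 t1]; apply/polyhedronE => i.
have -> : ((x + t *: (y - x)) *m G^T) 0 i =
    (x *m G^T) 0 i + t * ((y *m G^T) 0 i - (x *m G^T) 0 i).
  by rewrite mulmxDl -scalemxAl mulmxBl !mxE.
move: (Hx i) (Hy i); move: ((x *m G^T) 0 i) ((y *m G^T) 0 i) => a b ax bx.
have : (1 - t) * a <= (1 - t) * xi 0 i by rewrite ler_wpM2l// subr_ge0.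
have : t * b <= t * xi 0 i by rewrite ler_pM2l.
lra.
Qed.

Lemma polyhedronD xi d x e : e *m G^T = d ->
  polyhedron xi x -> polyhedron (xi + d) (x + e).
Proof.
move=> <- /polyhedronE Hx; apply/polyhedronE => i.
by rewrite mulmxDl !mxE lerD2r; have := Hx i; rewrite mxE.
Qed.

Hypotheses (m0 : (0 < m)%N) (fG : row_free G).

Lemma polyhedron_nonempty xi : polyhedron xi !=set0.
Proof.
have [e eG _] := gram_solve fG xi m0.
by exists e; apply/polyhedronE => i; rewrite eG.
Qed.

(* With [e] lifting [xi - xi'] through [G], the points [p' + e] and [p - e] are
   admissible in the two variational inequalities; with [d := p - p'] they add
   up to [<y - y' - d, e - d> <= 0], and [0 <= |d - (y - y') - e|^2] concludes. *)
Lemma polyhedron_proj_lipschitz (xi xi' : 'rV[R]_m) (y y' p p' : 'rV[R]_n) :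
  polyhedron xi p -> (forall z, polyhedron xi z -> inner (y - p) (z - p) <= 0) ->
  polyhedron xi' p' ->
  (forall z, polyhedron xi' z -> inner (y' - p') (z - p') <= 0) ->
  enorm (p - p') ^+ 2 <=
    enorm (y - y') ^+ 2 + enorm (xi - xi') ^+ 2 / lambda_min (G *m G^T).
Proof.
move=> Sp Hp Sp' Hp'.
have [lam0 _] := lambda_min_gram fG m0.
have [e eG eN] := gram_solve fG (xi - xi') m0.
have /Hp h : polyhedron xi (p' + e).
  by have := polyhedronD eG Sp'; rewrite addrC subrK.
have /Hp' h' : polyhedron xi' (p - e).
  have := @polyhedronD xi (- (xi - xi')) p (- e) _ Sp.
  by rewrite opprB addrCA subrr addr0; apply; rewrite mulNmx eG opprB.
have {eN}eN : inner e e <= enorm (xi - xi') ^+ 2 / lambda_min (G *m G^T).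
  rewrite -sqr_enorm -[X in _ <= _ / X](@sqr_sqrtr R) ?(ltW lam0)// -expr_div_n.
  by rewrite ler_sqr ?nnegrE ?divr_ge0 ?sqrtr_ge0 ?enorm_ge0.
apply: le_trans (lerD (lexx _) eN); rewrite !sqr_enorm.
have := inner_ge0 (p - p' - (y - y') - e).
move: h h'; rewrite !innerE.
rewrite (innerC p' p) (innerC y p) (innerC y' p) (innerC e p) (innerC y p').
rewrite (innerC y' p') (innerC e p') (innerC y' y) (innerC e y) (innerC e y').
lra.
Qed.

End polyhedron.

(** * Couplings and Wasserstein distance *)

Lemma probability_Rintegral_cst (d : measure_display) (T : measurableType d)
    (R : realType) (P : probability T R) (c : R) : \int[P]_x c = c.
Proof. by rewrite Rintegral_cst//= probability_setT mulr1. Qed.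

Lemma ae_mono (d : measure_display) (T : measurableType d) (R : realType)
    (mu : measure T R) (P Q : T -> Prop) :
  (forall x, P x -> Q x) -> {ae mu, forall x, P x} -> {ae mu, forall x, Q x}.
Proof. by move=> PQ; apply: filterS. Qed.

(** The difference [g - f] agrees almost everywhere with its positive part, whose integral is
    nonnegative. The almost-everywhere form is required because the loss is controlled only on
    [Z]. *)
Lemma le_Rintegral_ae (d : measure_display) (T : measurableType d)
    (R : realType) (mu : measure T R) (f g : T -> R) :
  mu.-integrable setT (EFin \o f) -> mu.-integrable setT (EFin \o g) ->
  {ae mu, forall x, f x <= g x} ->
  \int[mu]_x f x <= \int[mu]_x g x.
Proof.
move=> intf intg fg; rewrite -subr_ge0 -RintegralB//.
have intgf : mu.-integrable setT (EFin \o (fun x => g x - f x)).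
  by have := integrableB measurableT intg intf; apply: eq_integrable.
rewrite /Rintegral fine_ge0//.
rewrite (ae_eq_integral (fun x => (maxe 0 (g x - f x)%:E)%E)) //.
- by apply: integral_ge0 => x _; rewrite le_max lexx.
- exact: measurable_int intgf.
- by apply: measurable_maxe => //; exact: measurable_int intgf.
apply: filterS fg => x fgx _; apply/esym/max_idPr.
by rewrite lee_fin subr_ge0.
Qed.

(** * Transfer of integrals to an image measure, used for the marginals of a coupling *)

Section image_measure.
Context {d d' : measure_display} {X : measurableType d} {Y : measurableType d'}.
Context {R : realType} (pi : measure X R) (mu : measure Y R) (p : X -> Y).
Hypotheses (mp : measurable_fun setT p).
Hypothesis pimu : forall A, measurable A -> pi (p @^-1` A) = mu A.

Lemma image_measure_integrable (f : Y -> \bar R) :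
  mu.-integrable setT f -> pi.-integrable setT (f \o p).
Proof.
move=> /integrableP[mf fi]; apply/integrableP; split.
  exact: measurableT_comp.
rewrite -[X in (X < _)%E](@ge0_integral_pushforward _ _ _ _ _ _ mp pi setT
  (fun y => `|f y|%E)) //; last exact: measurableT_comp.
by rewrite (eq_measure_integral mu) => [|A mA _]; [exact: fi|exact: pimu].
Qed.

Lemma image_measure_Rintegral (f : Y -> R) :
  mu.-integrable setT (EFin \o f) ->
  \int[mu]_y f y = \int[pi]_x f (p x).
Proof.
move=> intf; congr fine.
rewrite -[RHS](@integral_pushforward _ _ _ _ _ _ mp pi setT (EFin \o f)) //.
- by apply: eq_measure_integral => A mA _; rewrite -pimu.
- exact: measurable_int intf.
- exact: image_measure_integrable.
Qed.

Lemma image_measure_ae (P : set Y) :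
  {ae mu, forall y, P y} -> {ae pi, forall x, P (p x)}.
Proof.
move=> [N [mN N0 PN]]; exists (p @^-1` N); split.
- by rewrite -[X in measurable X]setTI; exact: mp.
- by rewrite pimu.
- by move=> x /= nP; exact: PN.
Qed.

End image_measure.

Section borel.
Context {R : realType} {d : nat}.

Lemma continuous_borel_measurable (f : 'rV[R]_d -> R) : continuous f ->
  measurable_fun setT (f : borel_rV R d -> R).
Proof.
move=> /continuousP cf; apply: (measurability _ (RGenOpens.measurableE R)).
move=> _ [_ [a [b ->] <-]]; rewrite setTI; apply: sub_sigma_algebra.
exact/cf/interval_open.
Qed.

(** The sigma-algebra here is the product of two Borel sigma-algebras, so measurability is built up
    from the coordinates of each factor. *)
Lemma measurable_enormB :
  measurable_fun setT
    (fun q : borel_rV R d * borel_rV R d => enorm (q.1 - q.2 : 'rV[R]_d)).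
Proof.
apply: (measurableT_comp (continuous_measurable_fun (@sqrt_continuous R))).
have mc i : measurable_fun setT (fun q : borel_rV R d * borel_rV R d =>
    (q.1 - q.2 : 'rV[R]_d) 0 i).
  under eq_fun do rewrite !mxE.
  have mi := continuous_borel_measurable (@coord_continuous_rV R d i).
  apply: measurable_funB; first exact: measurableT_comp mi measurable_fst.
  exact: measurableT_comp mi measurable_snd.
apply: measurable_sum => i; exact: measurable_funM.
Qed.

(** The easy half of Kantorovich-Rubinstein duality: under any coupling the difference of
    expectations is at most [K] times the transport cost. *)
Lemma W1_dual (mu nu : probability (borel_rV R d) R) (Z : set 'rV[R]_d)
    (phi : 'rV[R]_d -> R) (K w : R) : 0 <= K ->
  {ae mu, forall z, Z z} -> {ae nu, forall z, Z z} ->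
  mu.-integrable setT (EFin \o phi) -> nu.-integrable setT (EFin \o phi) ->
  (forall z z', Z z -> Z z' -> phi z - phi z' <= K * enorm (z - z')) ->
  (W1 mu nu <= w%:E)%E ->
  \int[mu]_z phi z - \int[nu]_z phi z <= K * w.
Proof.
move=> K0 Zmu Znu imu inu phiK Ww; apply/ler_addgt0Pr => e e0.
(* A coupling of cost below [w + de] stands in for an optimal one; the [+ 1] gives [K * de <= e]
   even when [K = 0]. *)
pose de := e / (K + 1).
have K1 : 0 < K + 1 by rewrite ltr_wpDl.
have de0 : 0 < de by rewrite divr_gt0.
have Kde : K * de <= e.
  by rewrite /de mulrCA ger_pMr// ler_pdivrMr// mul1r lerDl.
have /ereal_inf_lt[_ [pi piP <-] piw] : (W1 mu nu < (w + de)%:E)%E.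
  by rewrite (le_lt_trans Ww)// lte_fin ltrDl.
have fstP A : measurable A -> pi (fst @^-1` A) = mu A.
  by move=> mA; have [<- _] := piP A mA; congr (pi _); apply/seteqP; split=> x //= [].
have sndP A : measurable A -> pi (snd @^-1` A) = nu A.
  by move=> mA; have [_ <-] := piP A mA; congr (pi _); apply/seteqP; split=> x //= [].
pose N (q : borel_rV R d * borel_rV R d) := enorm (q.1 - q.2 : 'rV[R]_d).
have iN : pi.-integrable setT (EFin \o N).
  apply/integrableP; split.
    by apply/measurable_EFinP; exact: measurable_enormB.
  under eq_integral do rewrite /= ger0_norm ?enorm_ge0//.
  exact: lt_trans piw (ltry _).
have i1 := image_measure_integrable (@measurable_fst _ _ _ _) fstP imu.
have i2 := image_measure_integrable (@measurable_snd _ _ _ _) sndP inu.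
rewrite (image_measure_Rintegral (@measurable_fst _ _ _ _) fstP imu).
rewrite (image_measure_Rintegral (@measurable_snd _ _ _ _) sndP inu).
rewrite -RintegralB//.
apply: (@le_trans _ _ (\int[pi]_q (K * N q))).
  apply: le_Rintegral_ae.
  - by have := integrableB measurableT i1 i2; apply: eq_integrable.
  - by have := integrableZl measurableT K iN; apply: eq_integrable.
  (* Both marginals are carried by [Z], so almost every pair lies in [Z] times [Z], where [phi] is
     Lipschitz. *)
  have Z1 := image_measure_ae (@measurable_fst _ _ _ _) fstP Zmu.
  have Z2 := image_measure_ae (@measurable_snd _ _ _ _) sndP Znu.
  by apply: filterS2 Z1 Z2 => q Z1 Z2; exact: phiK.
rewrite RintegralZl//; apply: (@le_trans _ _ (K * (w + de))); last first.
  by rewrite mulrDr lerD2l.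
rewrite ler_wpM2l// -lee_fin fineK; first exact: ltW.
exact: integrable_fin_num.
Qed.

End borel.

(** * Gradient of the expected loss *)

(** Along the [i]-th axis the difference quotient with increment [h] misses [g 0 i] by at most
    [C * |h|]. *)
Lemma gradient_quadratic_bound (R : realType) (n : nat) (f : 'rV[R]_n -> R)
    (x g : 'rV[R]_n) (C : R) : 0 <= C ->
  (forall v, `|f (x + v) - f x - inner g v| <= C * enorm v ^+ 2) ->
  gradient f x = g.
Proof.
move=> C0 H; apply/rowP => i; rewrite mxE /derive; apply/cvg_lim => //.
apply/cvgrPdist_le => e e0.
have C1 : 0 < C + 1 by rewrite ltr_wpDl.
near=> h.
have h0 : h != 0 by near: h; exact: nbhs_dnbhs_neq.
have he : `|h| <= e / (C + 1).
  near: h; apply: nbhs_dnbhs; apply/nbhs_normP; exists (e / (C + 1)).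
    exact: divr_gt0.
  by move=> y /=; rewrite sub0r normrN => /ltW.
have Hi := H (h *: delta_mx 0 i).
rewrite enormZ enorm_delta mulr1 innerZr inner_delta distrC (addrC x) in Hi.
suff : `|h^-1 * (h * g 0 i - (f (h *: delta_mx 0 i + x) - f x))| <= e.
  by rewrite mulrBr mulKf.
have hp : 0 < `|h| by rewrite normr_gt0.
rewrite normrM normfV ler_pdivrMl// (le_trans Hi)//.
rewrite expr2 mulrCA ler_pM2l// (le_trans (ler_wpM2l C0 he))//.
by rewrite mulrCA ger_pMr// ler_pdivrMr// mul1r lerDl.
Unshelve. all: by end_near. Qed.

(** A partial derivative in [x] is the joint differential applied to [(delta_mx 0 i, 0)], which
    varies continuously with [z]. This makes the gradient measurable in [z]. *)
Lemma gradient_continuous_param (R : realType) (n m : nat)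
    (l : 'rV[R]_n -> 'rV[R]_m -> R) (x : 'rV[R]_n) (i : 'I_n) :
  continuously_differentiable (fun p : 'rV[R]_n * 'rV[R]_m => l p.1 p.2) ->
  continuous (fun z => gradient (fun y => l y z) x 0 i).
Proof.
move=> [dl cl].
have -> : (fun z => gradient (fun y => l y z) x 0 i) =
    (fun p => 'd (fun p : 'rV[R]_n * 'rV[R]_m => l p.1 p.2) p
      (delta_mx 0 i, 0)) \o (fun z => (x, z)).
  apply/funext => z; rewrite mxE /= -deriveE// /derive.
  by under [in RHS]eq_fun do rewrite /= scaler0 add0r.
move=> z; apply: continuous_comp; last exact: cl.
exact: (@cvg_pair _ _ _ (nbhs z) (nbhs x) (nbhs z) _ _ _ (fun=> x) id (cvg_cst _) cvg_id).
Qed.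

Lemma le_integrable_ae (d : measure_display) (T : measurableType d)
    (R : realType) (mu : measure T R) (f g : T -> R) :
  measurable_fun setT f -> mu.-integrable setT (EFin \o g) ->
  {ae mu, forall x, `|f x| <= g x} -> mu.-integrable setT (EFin \o f).
Proof.
move=> mf /integrableP[mg gi] fg; apply/integrableP; split.
  exact/measurable_EFinP.
apply: le_lt_trans gi; apply: ae_ge0_le_integral => //.
- by apply: measurableT_comp => //; exact/measurable_EFinP.
- exact: measurableT_comp.
apply: filterS fg => x fgx _ /=; rewrite lee_fin.
exact: le_trans fgx (ler_norm _).
Qed.

Lemma Rintegral_sum (d : measure_display) (T : measurableType d)
    (R : realType) (mu : measure T R) (I : Type) (s : seq I) (h : I -> T -> R) :
  (forall i, mu.-integrable setT (EFin \o h i)) ->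
  \int[mu]_x (\sum_(i <- s) h i x) = \sum_(i <- s) \int[mu]_x h i x.
Proof.
move=> ih; elim: s => [|i s IH].
  rewrite big_nil -[RHS](mul0r (fine (mu setT))) -Rintegral_cst//.
  by apply: eq_Rintegral => x _; rewrite big_nil.
rewrite big_cons -IH -RintegralD//.
  by apply: eq_Rintegral => x _; rewrite big_cons.
have := integrable_sum (P := xpredT) measurableT s (fun i _ => ih i).
by apply: eq_integrable => // x _; rewrite /= sumEFin.
Qed.

Section integral_inner.
Context {d : measure_display} {T : measurableType d} {R : realType}.
Context (mu : measure T R) {n : nat} (F : T -> 'rV[R]_n) (v : 'rV[R]_n).
Hypothesis iF : forall i, mu.-integrable setT (EFin \o (fun t => F t 0 i)).

Let iFv i : mu.-integrable setT (EFin \o (fun t => F t 0 i * v 0 i)).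
Proof.
have := integrableZl measurableT (v 0 i) (iF i).
by apply: eq_integrable => // t _; rewrite /= mulrC EFinM.
Qed.

Lemma integrable_inner : mu.-integrable setT (EFin \o (fun t => inner (F t) v)).
Proof.
have := integrable_sum (P := xpredT) measurableT (index_enum 'I_n) (fun i _ => iFv i).
by apply: eq_integrable => // t _; rewrite /= sumEFin.
Qed.

Lemma Rintegral_inner :
  inner (\row_i \int[mu]_t F t 0 i) v = \int[mu]_t inner (F t) v.
Proof.
rewrite Rintegral_sum//; apply: eq_bigr => i _; rewrite mxE mulrC -RintegralZl//.
by apply: eq_Rintegral => t _; rewrite mulrC.
Qed.

End integral_inner.

(** * First-order estimates for the expected loss *)

Section expected_gradient.
Context {R : realType} {n m : nat} (l : 'rV[R]_n -> 'rV[R]_m -> R).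
Context (Z : set 'rV[R]_m) (gamma beta_x beta_z : R).

Definition expected_gradient (mu : probability (borel_rV R m) R)
    (x : 'rV[R]_n) : 'rV[R]_n :=
  \row_i \int[mu]_z gradient (fun y => l y z) x 0 i.

Local Notation grad z x := (gradient (fun y => l y z) x).
Local Notation Egrad := expected_gradient.

Hypotheses (gamma0 : 0 <= gamma) (beta_x0 : 0 <= beta_x) (beta_z0 : 0 <= beta_z).
Hypothesis strong_convex : forall z, Z z -> forall x1 x2,
  l x2 z + inner (grad z x2) (x1 - x2) + gamma / 2 * enorm (x1 - x2) ^+ 2
    <= l x1 z.
Hypothesis lipschitz_z : forall x z z', Z z -> Z z' ->
  enorm (grad z x - grad z' x) <= beta_z * enorm (z - z').
Hypothesis lipschitz_x : forall x1 x2 z, Z z ->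
  enorm (grad z x1 - grad z x2) <= beta_x * enorm (x1 - x2).
Hypothesis grad_measurable : forall x i,
  measurable_fun setT (fun z : borel_rV R m => grad z x 0 i).

(** The lower bound is convexity at [x]. For the upper bound, convexity at [x + v] bounds the
    increment by [<grad l(x + v, z), v>], and the Lipschitz gradient moves the base point back to
    [x]. *)
Lemma loss_linear_bounds z x v : Z z ->
  0 <= l (x + v) z - (l x z + inner (grad z x) v) <= beta_x * enorm v ^+ 2.
Proof.
move=> Zz; apply/andP; split.
  have := strong_convex Zz (x + v) x.
  rewrite (addrC x) addrK => h; rewrite subr_ge0 (le_trans _ h)// lerDl.
  by rewrite mulr_ge0 ?divr_ge0 ?sqr_ge0.
have := strong_convex Zz x (x + v).
rewrite opprD addrA subrr add0r innerNr enormN => h.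
have g0 : 0 <= gamma / 2 * enorm v ^+ 2 by rewrite mulr_ge0 ?divr_ge0 ?sqr_ge0.
have := inner_le_enorm (grad z (x + v) - grad z x) v.
have := ler_wpM2r (enorm_ge0 v) (lipschitz_x (x + v) x Zz).
rewrite (addrC x v) addrK (addrC v x) innerDl innerNl expr2; lra.
Qed.

Section fixed_distribution.
Variable mu : probability (borel_rV R m) R.
Hypothesis Zmu : {ae mu, forall z, Z z}.
Hypothesis first_moment :
  mu.-integrable setT (fun z => (enorm (z : 'rV[R]_m))%:E).
Hypothesis loss_integrable : forall x, mu.-integrable setT (fun z => (l x z)%:E).

(** Were [Z] empty, the exceptional null set would have probability 1. The point obtained serves as
    reference in the integrability bound below. *)
Lemma ae_nonempty : exists z, Z z.
Proof.
apply: contrapT => nZ; case: Zmu => N [mN N0 ZN].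
have : (mu N = 1)%E.
  rewrite -(@probability_setT _ _ _ mu); congr (mu _).
  by apply/seteqP; split => // z _; apply: ZN => Zz; apply: nZ; exists z.
by rewrite N0 => /eqP; rewrite eqe eq_sym oner_eq0.
Qed.

(** Comparison with the gradient at a fixed [z0] in [Z] bounds the coordinate by an affine function
    of [enorm z], integrable by the first-moment assumption. *)
Lemma grad_coord_integrable x i :
  mu.-integrable setT (EFin \o (fun z => grad z x 0 i)).
Proof.
have [z0 Zz0] := ae_nonempty.
pose c := `|grad z0 x 0 i| + beta_z * enorm z0.
apply: (@le_integrable_ae _ (borel_rV R m) _ mu _ (fun z : 'rV[R]_m => beta_z * enorm z + c)) => //.
  have i1 := integrableZl measurableT beta_z first_moment.
  have i2 := finite_measure_integrable_cst mu c measurableT.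
  by have := integrableD measurableT i1 i2; apply: eq_integrable.
apply: (ae_mono _ Zmu) => z Zz.
have -> : grad z x 0 i = (grad z x - grad z0 x) 0 i + grad z0 x 0 i.
  by rewrite !mxE subrK.
rewrite (le_trans (ler_normD _ _))// /c addrCA addrC lerD2r.
rewrite (le_trans (normr_coord_le _ _))// (le_trans (lipschitz_z _ Zz Zz0))//.
by rewrite -mulrDr ler_wpM2l// (le_trans (enormD _ _))// enormN.
Qed.

Lemma inner_grad_integrable x v :
  mu.-integrable setT (EFin \o (fun z => inner (grad z x) v)).
Proof.
exact: (@integrable_inner _ (borel_rV R m) _ mu _ _ v (grad_coord_integrable x)).
Qed.

Lemma inner_expected_gradient x v :
  inner (Egrad mu x) v = \int[mu]_z inner (grad z x) v.
Proof.
exact: (@Rintegral_inner _ (borel_rV R m) _ mu _ _ v (grad_coord_integrable x)).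
Qed.

Local Notation f x := (\int[mu]_z l x z).

Lemma linear_integrable x v : mu.-integrable setT
  (EFin \o (fun z => l x z + inner (grad z x) v)).
Proof.
have := integrableD measurableT (loss_integrable x) (inner_grad_integrable x v).
exact: eq_integrable.
Qed.

Lemma Rintegral_linear x v :
  \int[mu]_z (l x z + inner (grad z x) v) = f x + inner (Egrad mu x) v.
Proof.
rewrite RintegralD => [|||]; first by rewrite inner_expected_gradient.
- by [].
- exact: loss_integrable.
- exact: inner_grad_integrable.
Qed.

Lemma expected_loss_linear_bounds x v :
  0 <= f (x + v) - (f x + inner (Egrad mu x) v) <= beta_x * enorm v ^+ 2.
Proof.
have iD c : mu.-integrable setT
    (EFin \o (fun z => l x z + inner (grad z x) v + c)).
  have := integrableD measurableT (linear_integrable x v)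
    (finite_measure_integrable_cst mu c measurableT).
  exact: eq_integrable.
rewrite -Rintegral_linear subr_ge0; apply/andP; split.
  apply: le_Rintegral_ae; [exact: linear_integrable|exact: loss_integrable|].
  apply: (ae_mono _ Zmu) => z Zz.
  by have /andP[] := loss_linear_bounds x v Zz; rewrite subr_ge0.
rewrite lerBlDl.
have -> : \int[mu]_z (l x z + inner (grad z x) v) + beta_x * enorm v ^+ 2 =
    \int[mu]_z (l x z + inner (grad z x) v + beta_x * enorm v ^+ 2).
  rewrite [RHS]RintegralD => [|||]; first by rewrite probability_Rintegral_cst.
  - by [].
  - exact: linear_integrable.
  - exact: finite_measure_integrable_cst.
apply: le_Rintegral_ae; [exact: loss_integrable|exact: iD|].
apply: (ae_mono _ Zmu) => z Zz.
by have /andP[_] := loss_linear_bounds x v Zz; rewrite lerBlDl.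
Qed.

(** Differentiation under the integral sign: the quadratic remainder bound is uniform over [Z] and
    therefore survives integration. *)
Lemma gradient_expected_loss x : gradient (fun y => f y) x = Egrad mu x.
Proof.
apply: (gradient_quadratic_bound beta_x0) => v.
rewrite -addrA -opprD ger0_norm.
  by have /andP[] := expected_loss_linear_bounds x v.
by have /andP[] := expected_loss_linear_bounds x v.
Qed.

Lemma expected_gradient_monotone x1 x2 :
  gamma * enorm (x1 - x2) ^+ 2 <=
    inner (Egrad mu x1 - Egrad mu x2) (x1 - x2).
Proof.
rewrite innerDl innerNl !inner_expected_gradient -RintegralB//;
  try exact: inner_grad_integrable.
have -> : gamma * enorm (x1 - x2) ^+ 2 =
    \int[mu]_z (gamma * enorm (x1 - x2) ^+ 2).
  by rewrite probability_Rintegral_cst.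
apply: le_Rintegral_ae.
- exact: finite_measure_integrable_cst.
- have := integrableB measurableT (inner_grad_integrable x1 (x1 - x2))
    (inner_grad_integrable x2 (x1 - x2)).
  exact: eq_integrable.
apply: (ae_mono _ Zmu) => z Zz.
(* Adding the two inequalities cancels the losses and doubles [gamma / 2]. *)
have := strong_convex Zz x1 x2; have := strong_convex Zz x2 x1.
rewrite -(opprB x1 x2) innerNr enormN; lra.
Qed.

Lemma expected_gradient_lipschitz x1 x2 :
  enorm (Egrad mu x1 - Egrad mu x2) <= beta_x * enorm (x1 - x2).
Proof.
apply: enorm_le_inner => [|v]; first by rewrite mulr_ge0 ?enorm_ge0.
rewrite innerDl innerNl !inner_expected_gradient -RintegralB//;
  try exact: inner_grad_integrable.
have -> : beta_x * enorm (x1 - x2) * enorm v =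
    \int[mu]_z (beta_x * enorm (x1 - x2) * enorm v).
  by rewrite probability_Rintegral_cst.
apply: le_Rintegral_ae.
- have := integrableB measurableT (inner_grad_integrable x1 v)
    (inner_grad_integrable x2 v).
  exact: eq_integrable.
- exact: finite_measure_integrable_cst.
apply: (ae_mono _ Zmu) => z Zz.
rewrite -innerNl -innerDl (le_trans (inner_le_enorm _ _))//.
by rewrite ler_wpM2r ?enorm_ge0// lipschitz_x.
Qed.

(** Minimality along the segment and the quadratic upper bound leave an inequality in [t] whose
    linear coefficient is the inner product. *)
Lemma expected_loss_argmin_variational (S : set 'rV[R]_n) x y :
  (forall t : R, 0 < t <= 1 -> S (x + t *: (y - x))) ->
  argmin S (fun u => f u) x -> 0 <= inner (Egrad mu x) (y - x).
Proof.
move=> Sxy [_ minx].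
apply: (@linear_coef_ge0 _ _ (beta_x * enorm (y - x) ^+ 2)) => t t01.
have /andP[_] := expected_loss_linear_bounds x (t *: (y - x)).
have := minx _ (Sxy t t01).
rewrite enormZ exprMn innerZr; case/andP: t01 => t0 _.
rewrite (gtr0_norm t0); lra.
Qed.

End fixed_distribution.

(** For fixed [v], the function [z |-> <grad l(x, z), v>] is Lipschitz on [Z] with constant
    [beta_z * enorm v], so duality applies. *)
Lemma expected_gradient_W1 (mu nu : probability (borel_rV R m) R) x (w : R) :
  {ae mu, forall z, Z z} -> {ae nu, forall z, Z z} ->
  mu.-integrable setT (fun z => (enorm (z : 'rV[R]_m))%:E) ->
  nu.-integrable setT (fun z => (enorm (z : 'rV[R]_m))%:E) ->
  0 <= w -> (W1 mu nu <= w%:E)%E ->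
  enorm (Egrad mu x - Egrad nu x) <= beta_z * w.
Proof.
move=> Zmu Znu imu inu w0 Ww.
apply: enorm_le_inner => [|v]; first exact: mulr_ge0.
rewrite innerDl innerNl !inner_expected_gradient// (mulrAC beta_z).
apply: (W1_dual _ Zmu Znu _ _ _ Ww).
- by rewrite mulr_ge0 ?enorm_ge0.
- exact: inner_grad_integrable.
- exact: inner_grad_integrable.
move=> z z' Zz Zz'; rewrite -innerNl -innerDl (le_trans (inner_le_enorm _ _))//.
by rewrite (mulrAC beta_z) ler_wpM2r ?enorm_ge0// lipschitz_z.
Qed.

End expected_gradient.

Lemma exp_rhs_W1 (R : realType) (n d : nat)
    (D : 'rV[R]_n -> probability (borel_rV R d) R) x y (w : R) :
  (forall x, (D x).-integrable setT (fun z => (enorm (z : 'rV[R]_d))%:E)) ->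
  0 <= w -> (W1 (D x) (D y) <= w%:E)%E ->
  enorm (exp_rhs D x - exp_rhs D y) <= w.
Proof.
move=> iD w0 Ww.
have ic u i : (D u).-integrable setT (EFin \o (fun z : 'rV[R]_d => z 0 i)).
  apply: (@le_integrable_ae _ (borel_rV R d) _ _ _ (@enorm R d) _ (iD u)).
    by apply: continuous_borel_measurable; exact: coord_continuous_rV.
  by apply: aeW => z; exact: normr_coord_le.
have iv u v := @integrable_inner _ (borel_rV R d) _ (D u) _ id v (ic u).
have E u v := @Rintegral_inner _ (borel_rV R d) _ (D u) _ id v (ic u).
apply: enorm_le_inner => // v.
rewrite innerDl innerNl !E mulrC.
apply: (@W1_dual _ _ _ _ setT) Ww => //; rewrite ?enorm_ge0//.
- exact: aeW.
- exact: aeW.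
- exact: iv.
- exact: iv.
move=> z z' _ _; rewrite -innerNl -innerDl mulrC.
exact: inner_le_enorm.
Qed.

(** * Contraction *)

(** [s1] and [s2] are the roots of [c2 eta^2 - 2 c1 eta + c0], and [s1 >= 0] because
    [Delta <= (2 c1)^2]. *)
Lemma quadratic_between_roots (R : rcfType) (c0 c1 c2 : R) :
  0 < c2 -> 0 <= c1 -> 0 <= c0 ->
  let Delta := 4 * c1 ^+ 2 - 4 * c2 * c0 in
  let s1 := (2 * c1 - Num.sqrt Delta) / (2 * c2) in
  let s2 := (2 * c1 + Num.sqrt Delta) / (2 * c2) in
  0 < Delta ->
  [/\ s1 < s2, 0 <= s1 &
    forall eta, s1 < eta < s2 -> c2 * eta ^+ 2 - 2 * eta * c1 + c0 < 0].
Proof.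
move=> c2_0 c1_0 c0_0 Delta s1 s2 D0.
have r0 : 0 < Num.sqrt Delta by rewrite sqrtr_gt0.
have rE : Num.sqrt Delta ^+ 2 = Delta by rewrite sqr_sqrtr// ltW.
have cc : 0 < 2 * c2 by lra.
split.
- by rewrite ltr_pM2r ?invr_gt0//; lra.
- rewrite divr_ge0 ?(ltW cc)// subr_ge0.
  rewrite -ler_sqr ?nnegrE ?sqrtr_ge0 ?mulr_ge0// rE /Delta.
  have : 0 <= c2 * c0 by rewrite mulr_ge0// ltW.
  lra.
move=> eta; rewrite ltr_pdivrMr// ltr_pdivlMr// => /andP[lo hi].
(* The product of the two positive gaps is [Delta - (2 c2 eta - 2 c1)^2], that is, [- 4 c2] times
   the quadratic. *)
have : 0 < (eta * (2 * c2) - (2 * c1 - Num.sqrt Delta)) *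
    (2 * c1 + Num.sqrt Delta - eta * (2 * c2)).
  by rewrite mulr_gt0 ?subr_gt0.
have -> : (eta * (2 * c2) - (2 * c1 - Num.sqrt Delta)) *
    (2 * c1 + Num.sqrt Delta - eta * (2 * c2)) =
    Num.sqrt Delta ^+ 2 - (eta * (2 * c2) - 2 * c1) ^+ 2 by ring.
rewrite rE (_ : _ - _ =
  (4 * c2) * - (c2 * eta ^+ 2 - 2 * eta * c1 + c0)); last by rewrite /Delta; ring.
by rewrite pmulr_rgt0 ?oppr_gt0//; lra.
Qed.

Lemma enorm_gradient_step (R : realType) (n : nat) (v g : 'rV[R]_n)
    (a b eta : R) : 0 <= eta -> a * enorm v ^+ 2 <= inner g v ->
  enorm g <= b * enorm v ->
  enorm (v - eta *: g) ^+ 2 <=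
    (1 - 2 * eta * a + eta ^+ 2 * b ^+ 2) * enorm v ^+ 2.
Proof.
move=> eta0 gv gb.
have b0 : 0 <= b * enorm v by rewrite (le_trans _ gb)// enorm_ge0.
have : enorm g ^+ 2 <= (b * enorm v) ^+ 2 by rewrite ler_sqr ?nnegrE ?enorm_ge0.
move=> /(ler_wpM2l (sqr_ge0 eta)); have := ler_wpM2l eta0 gv.
rewrite exprMn [enorm (v - _) ^+ 2]sqr_enorm !innerE (innerC v g) -!sqr_enorm; lra.
Qed.

Theorem theorem1 (R : realType) (n dw dz : nat) (hdw : (0 < dw)%N)
  (G : 'M[R]_(dw, n)) (l : 'rV[R]_n -> 'rV[R]_dz -> R)
  (Z : set 'rV[R]_dz)
  (D : 'rV[R]_n -> probability (borel_rV R dz) R)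
  (Dg : 'rV[R]_n -> probability (borel_rV R dw) R)
  (gamma beta_x beta_z eps eps_g : R)
  (hl : twice_continuously_differentiable
          (fun p : 'rV[R]_n * 'rV[R]_dz => l p.1 p.2))
  (hZ : forall x : 'rV[R]_n, {ae D x, forall z, Z z})
  (hD1 : forall x : 'rV[R]_n,
     (D x).-integrable setT (fun z => (enorm (z : 'rV[R]_dz))%:E))
  (hDg1 : forall x : 'rV[R]_n,
     (Dg x).-integrable setT (fun w => (enorm (w : 'rV[R]_dw))%:E))
  (hlint : forall x' x : 'rV[R]_n,
     (D x').-integrable setT (fun z => (l x z)%:E))
  (hgamma : 0 < gamma) (hbeta_x : 0 <= beta_x) (hbeta_z : 0 <= beta_z)
  (heps : 0 <= eps) (heps_g : 0 <= eps_g)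
  (A1 : forall z : 'rV[R]_dz, Z z -> forall x1 x2 : 'rV[R]_n,
     l x2 z + inner (gradient (fun x => l x z) x2) (x1 - x2)
       + gamma / 2 * enorm (x1 - x2) ^+ 2 <= l x1 z)
  (A2z : forall (x : 'rV[R]_n) (z z' : 'rV[R]_dz), Z z -> Z z' ->
     enorm (gradient (fun y => l y z) x - gradient (fun y => l y z') x)
       <= beta_z * enorm (z - z'))
  (A2x : forall (x1 x2 : 'rV[R]_n) (z : 'rV[R]_dz), Z z ->
     enorm (gradient (fun y => l y z) x1 - gradient (fun y => l y z) x2)
       <= beta_x * enorm (x1 - x2))
  (A3 : forall x y : 'rV[R]_n,
     (W1 (D x) (D y) <= (eps * enorm (x - y))%:E)%E)
  (A3g : forall x y : 'rV[R]_n,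
     (W1 (Dg x) (Dg y) <= (eps_g * enorm (x - y))%:E)%E)
  (A4 : row_free G)
  (xs : 'rV[R]_n) (hxs : equilibrium l G D Dg xs)
  (h1 : 0 < gamma - eps * beta_z
            - eps_g * (eps * beta_z + beta_x)
                / Num.sqrt (lambda_min (G *m G^T)))
  (h2 : 0 < (gamma - eps * beta_z) ^+ 2
            - 2 * eps_g * (eps * beta_z + beta_x) * (gamma + beta_x)
                / Num.sqrt (lambda_min (G *m G^T))) :
  let lam := lambda_min (G *m G^T) in
  let c2 := (eps * beta_z + beta_x) ^+ 2 in
  let c1 := gamma - eps * beta_z
            - eps_g * (eps * beta_z + beta_x) / Num.sqrt lam in
  let c0 := eps_g ^+ 2 / lam + 2 * eps_g / Num.sqrt lam in
  let Delta := 4 * c1 ^+ 2 - 4 * c2 * c0 in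
  let s1 := (2 * c1 - Num.sqrt Delta) / (2 * c2) in
  let s2 := (2 * c1 + Num.sqrt Delta) / (2 * c2) in
  [/\ s1 < s2, 0 <= s1 &
    forall eta : R, s1 < eta < s2 ->
      let kappa := c2 * eta ^+ 2 - 2 * eta * c1 + c0 + 1 in
      kappa < 1 /\
      forall x : nat -> 'rV[R]_n,
        (forall t, x t.+1 = rpgd_step l G D Dg eta (x t)) ->
        forall t : nat,
          enorm (x t.+1 - xs) ^+ 2 <= kappa ^+ t * enorm (x 1%N - xs) ^+ 2].
Proof.
move=> lam c2 c1 c0 Delta s1 s2.
have [lam0 _] := lambda_min_gram A4 hdw.
(* [s] bounds the displacement of the feasible set per unit change of the decision. In these terms
   [c1 = a - s b] and [c0 = s^2 + 2 s]. *)
pose s := eps_g / Num.sqrt lam; pose a := gamma - eps * beta_z.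
pose b := eps * beta_z + beta_x.
have q0 : 0 < Num.sqrt lam by rewrite sqrtr_gt0.
have s0 : 0 <= s by rewrite divr_ge0// ltW.
have ebz : 0 <= eps * beta_z by rewrite mulr_ge0.
have b0 : 0 <= b by rewrite addr_ge0.
have s2E : eps_g ^+ 2 / lam = s ^+ 2.
  by rewrite /s expr_div_n sqr_sqrtr// ltW.
have c1E : c1 = a - s * b by rewrite /c1 /s mulrAC.
have c0E : c0 = s ^+ 2 + 2 * s by rewrite /c0 s2E /s mulrA.
have a0 : 0 < a.
  have : 0 < a - s * b by rewrite -c1E.
  have : 0 <= s * b by rewrite mulr_ge0.
  lra.
pose E := expected_gradient l.
have mg x i : measurable_fun setT
    (fun z : borel_rV R dz => gradient (fun y => l y z) x 0 i).
  apply: continuous_borel_measurable; apply: gradient_continuous_param.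
  by case: hl.
have gE x y : gradient (exp_loss l D x) y = E (D x) y.
  exact: (gradient_expected_loss (ltW hgamma) hbeta_x hbeta_z A1 A2z A2x mg
    (hZ x) (hD1 x) (hlint x)).
have mono x := expected_gradient_monotone hbeta_z A1 A2z mg (hZ x) (hD1 x).
have lip x := expected_gradient_lipschitz hbeta_x hbeta_z A2z A2x mg (hZ x) (hD1 x).
(* Strong monotonicity and the Lipschitz bound are compared on a unit vector, which exists since
   [0 < dw = rank G <= n]. Hence [a <= b], so that [c2 > 0]. *)
have gb : gamma <= beta_x.
  have n0 : (0 < n)%N.
    by have := rank_leq_col G; move/eqP: A4 => ->; apply: leq_trans.
  pose e : 'rV[R]_n := delta_mx 0 (Ordinal n0).
  have := le_trans (mono 0 e 0) (inner_le_enorm _ _).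
  rewrite subr0 enorm_delta expr1n !mulr1 => h; apply: (le_trans h).
  by have := lip 0 e 0; rewrite subr0 enorm_delta mulr1.
have ab : a <= b by rewrite /a /b; lra.
have bpos : 0 < b by exact: lt_le_trans a0 ab.
have c2_0 : 0 < c2 by rewrite exprn_gt0.
have c0_0 : 0 <= c0 by rewrite c0E addr_ge0 ?sqr_ge0// mulr_ge0.
have D0 : 0 < Delta.
  (* The terms [s^2 b^2] cancel in [c1^2 - c2 c0], leaving [a^2 - 2 s b (a + b)] with
     [a + b = gamma + beta_x]: this is the quantity in [h2]. *)
  have -> : Delta = 4 * ((gamma - eps * beta_z) ^+ 2 -
      2 * eps_g * (eps * beta_z + beta_x) * (gamma + beta_x) / Num.sqrt lam).
    rewrite /Delta c1E c0E /c2 /s /a /b; field.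
    by rewrite gt_eqF.
  by rewrite mulr_gt0.
have c1_0 : 0 <= c1 := ltW h1.
have [s12 s1_0 window] := quadratic_between_roots c2_0 c1_0 c0_0 D0.
split=> // eta /[dup] eta12 /window k1 kappa; split.
  by rewrite /kappa gtrDr.
have eta0 : 0 < eta by case/andP: eta12 => s1e _; exact: le_lt_trans s1_0 s1e.
move=> x xS.
pose r := 1 - 2 * eta * a + eta ^+ 2 * b ^+ 2.
have kE : kappa = r + s ^+ 2 + (2 * eta * (s * b) + 2 * s).
  by rewrite /kappa c1E c0E /c2 -/b /r; ring.
have rest0 : 0 <= 2 * eta * (s * b) + 2 * s.
  by rewrite addr_ge0 ?mulr_ge0// ltW.
(* Since [a <= b], [r] is at least [(1 - eta a)^2]. The resulting sign of [kappa] is used in the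
   final induction. *)
have r0 : 0 <= r.
  have : eta ^+ 2 * a ^+ 2 <= eta ^+ 2 * b ^+ 2.
    by rewrite ler_pM2l ?exprn_gt0// ler_sqr// nnegrE ltW.
  have := sqr_ge0 (1 - eta * a); rewrite /r; lra.
have kappa0 : 0 <= kappa by rewrite kE addr_ge0 ?(addr_ge0 r0 (sqr_ge0 s)).
have step y : enorm (rpgd_step l G D Dg eta y - xs) ^+ 2 <=
    kappa * enorm (y - xs) ^+ 2.
  have PP u := @euclidean_projP _ _ _ (polyhedron_nonempty hdw A4 (exp_rhs Dg u))
    (@closed_polyhedron _ _ _ G (exp_rhs Dg u)) (@convex_polyhedron _ _ _ G (exp_rhs Dg u)).
  have [Sp vp] := PP y (y - eta *: gradient (exp_loss l D y) y).
  have [Sxs minxs] := hxs.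
  (* By optimality, [xs] satisfies the variational inequality of the projection of its own gradient
     step: the equilibrium is a fixed point of the update. *)
  have vxs z : polyhedron G (exp_rhs Dg xs) z ->
      inner (xs - eta *: E (D xs) xs - xs) (z - xs) <= 0.
    move=> Sz; rewrite addrAC subrr add0r innerNl innerZl oppr_le0.
    rewrite mulr_ge0 ?(ltW eta0)//.
    apply: (expected_loss_argmin_variational (ltW hgamma) hbeta_z A1 A2z A2x mg
      (hZ xs) (hD1 xs) (hlint xs) _ hxs) => t t01.
    exact: convex_polyhedron.
  have := polyhedron_proj_lipschitz hdw A4 Sp vp Sxs vxs.
  rewrite -/(rpgd_step l G D Dg eta y) -/lam => /le_trans; apply.
  have w0 := enorm_ge0 (y - xs).
  have hrhs : enorm (exp_rhs Dg y - exp_rhs Dg xs) ^+ 2 / lam <=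
      s ^+ 2 * enorm (y - xs) ^+ 2.
    rewrite -s2E [leRHS]mulrAC -exprMn ler_pM2r ?invr_gt0//.
    rewrite ler_sqr ?nnegrE ?enorm_ge0 ?mulr_ge0//.
    exact: exp_rhs_W1 hDg1 (mulr_ge0 heps_g w0) (A3g y xs).
  have hE : enorm (E (D y) xs - E (D xs) xs) <= eps * beta_z * enorm (y - xs).
    rewrite (mulrC eps) -mulrA.
    exact: (expected_gradient_W1 hbeta_z A2z mg xs (hZ y) (hZ xs) (hD1 y) (hD1 xs)
      (mulr_ge0 heps w0) (A3 y xs)).
  pose g := E (D y) y - E (D xs) xs.
  (* First the point moves under the fixed distribution [D y], which brings in [gamma] and [beta_x];
     then the distribution moves at the fixed point [xs], at cost [eps * beta_z]. *)
  have gsplit : g = E (D y) y - E (D y) xs + (E (D y) xs - E (D xs) xs).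
    by rewrite addrA subrK.
  have g1 : a * enorm (y - xs) ^+ 2 <= inner g (y - xs).
    have := inner_le_enorm (- (E (D y) xs - E (D xs) xs)) (y - xs).
    rewrite innerNl enormN => h.
    rewrite gsplit innerDl /a; have := ler_wpM2r w0 hE.
    have := mono y y xs; rewrite -/E expr2; lra.
  have g2 : enorm g <= b * enorm (y - xs).
    rewrite gsplit (le_trans (enormD _ _))// /b mulrDl addrC.
    by rewrite lerD// lip.
  have hu := enorm_gradient_step (ltW eta0) g1 g2.
  have -> : y - eta *: gradient (exp_loss l D y) y - (xs - eta *: E (D xs) xs) =
      y - xs - eta *: g.
    by rewrite gE /g scalerBr !opprD !opprK addrACA.
  apply: (le_trans (lerD hu hrhs)); rewrite -mulrDl -/r ler_wpM2r ?sqr_ge0// kE.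
  by rewrite lerDl.
(* The count starts at [x 1], so the case [t = 0] is an equality. *)
elim=> [|t IH]; first by rewrite expr0 mul1r.
rewrite xS (le_trans (step _))// (exprS kappa) -mulrA ler_wpM2l//.
Qed.
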